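(* Let $\mathcal{E}$ be a Euclidean vector space and $C$ a nonempty closed subset of $\mathcal{E}$. For every $x\in C$ where $C$ is not Clarke regular, there exist a sequence $(x_i)_{i\in\mathbb{N}}$ in $C$ converging to $x$ and a continuously differentiable function $\varphi:\mathcal{E}\to\mathbb{R}$ such that $\lim_{i\to\infty}\mathrm{s}(x_i;\varphi,C)=0$ and $\lim_{i\to\infty}d(-\nabla\varphi(x_i),\widehat N_C(x_i))=0$, yet $-\nabla\varphi(x)\in N_C(x)\setminus\widehat N_C(x)$.
   Context: $\mathcal{E}$ is a finite-dimensional real inner product space. For a nonempty set $S$, $d(x,S)=\inf_{y\in S}\|x-y\|$ and $P_S(x)=\operatorname{argmin}_{y\in S}\|x-y\|$. For $x\in C$: the tangent cone $T_C(x)$ is the set of all $v$ for which there exist sequences $(x_i)$ in $C$ converging to $x$ and $(t_i)$ in $(0,\infty)$ with $(x_i-x)/t_i\to v$ (a closed cone); the regular normal cone is $\widehat N_C(x)=\{w\mid\langle v,w\rangle\le 0\ \forall v\in T_C(x)\}$; the normal cone $N_C(x)$ is the set of all $w$ for which there exist sequences $(x_i)$ in $C$ converging to $x$ and $(w_i)$ converging to $w$ with $w_i\in\widehat N_C(x_i)$ for all $i$. One always has $\widehat N_C(x)\subseteq N_C(x)$; the closed set $C$ is Clarke regular at $x$ if $\widehat N_C(x)=N_C(x)$. For differentiable $\varphi:\mathcal{E}\to\mathbb{R}$ and $x\in C$, $\mathrm{s}(x;\varphi,C)$ is the common norm of all elements of $P_{T_C(x)}(-\nabla\varphi(x))$,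 i.e. $\mathrm{s}(x;\varphi,C)=\sqrt{\|\nabla\varphi(x)\|^2-d(-\nabla\varphi(x),T_C(x))^2}$. *)

(* Defs.v *)
From HB Require Import structures.
From mathcomp Require Import all_boot all_order all_algebra.
From mathcomp Require Import all_classical all_reals all_analysis.
From mathcomp Require Import ring lra.

Set Implicit Arguments.
Unset Strict Implicit.
Unset Printing Implicit Defensive.
Import Order.TTheory GRing.Theory Num.Theory.
Import numFieldNormedType.Exports.

Local Open Scope classical_set_scope.
Local Open Scope ring_scope.

(* The library's norm on 'rV[R]_n is the max norm, so R^n in its library form is
   not Euclidean. Here the norm, hence also the topology and the differential,
   is the one induced by the inner product. *)
HB.mixin Record NormedVector_isEuclidean (R : realType) E
    of NormedModule R E & Vector R E := {
  inner : {dot E for idfun} ;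
  inner_normE : forall u : E, inner u u = `|u| ^+ 2
}.

#[short(type="euclideanType")]
HB.structure Definition Euclidean (R : realType) :=
  {E of NormedModule R E & Vector R E & NormedVector_isEuclidean R E}.

Section Definitions.
Context {R : realType} {E : euclideanType R}.
Implicit Types (S C : set E) (x u v w : E) (phi : E -> R).

Definition set_dist x S : R := inf [set `|x - y| | y in S].

Definition proj_set S x : set E :=
  [set y | S y /\ forall z, S z -> `|x - y| <= `|x - z|].

Definition tangent_cone C x : set E :=
  [set v | exists (xs : nat -> E) (t : nat -> R),
    [/\ forall i, C (xs i), xs @ \oo --> x, forall i, 0 < t i &
        (fun i => (t i)^-1 *: (xs i - x)) @ \oo --> v]].

Definition regular_normal_cone C x : set E :=
  [set w | forall v, tangent_cone C x v -> inner w v <= 0].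

Definition normal_cone C x : set E :=
  [set w | exists xs ws : nat -> E,
    [/\ forall i, C (xs i), xs @ \oo --> x, ws @ \oo --> w &
        forall i, regular_normal_cone C (xs i) (ws i)]].

Definition clarke_regular C x := regular_normal_cone C x = normal_cone C x.

(* The Riesz representative of the differential, see gradientP. *)
Definition gradient phi x : E :=
  get [set g : E | forall v, 'd phi x v = inner g v].

Definition continuously_differentiable phi :=
  (forall x, differentiable phi x) /\ continuous (gradient phi).

(* The common norm of all the projections of - gradient phi x onto the tangent
   cone, see stationarity_proj. *)
Definition stationarity phi C x : R :=
  Num.sqrt (`|gradient phi x| ^+ 2 -
            set_dist (- gradient phi x) (tangent_cone C x) ^+ 2).

Lemma innerC u v : inner u v = inner v u.
Proof. by rewrite hermC /= expr0 mul1r. Qed.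

Lemma gradientP phi x v : 'd phi x v = inner (gradient phi x) v.
Proof.
move: v; suff : exists g : E, forall v, 'd phi x v = inner g v by exact: getPex.
pose b := vbasis {: E}.
pose F (g : E) : 'rV[R]_(\dim {: E}) := \row_i inner g b`_i.
have linF : linear F.
  by move=> a u v; apply/rowP => i; rewrite !mxE linearPl.
pose F' : {linear E -> 'rV[R]_(\dim {: E})} :=
  HB.pack F (GRing.isLinear.Build _ _ _ _ F linF).
have eq_on_basis (h k : E -> R) : linear h -> linear k ->
    (forall i : 'I_(\dim {: E}), h b`_i = k b`_i) -> h =1 k.
  move=> lh lk hk v.
  pose h' : {linear E -> R^o} := HB.pack h (GRing.isLinear.Build _ _ _ _ h lh).
  pose k' : {linear E -> R^o} := HB.pack k (GRing.isLinear.Build _ _ _ _ k lk).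
  rewrite (coord_vbasis (memvf v)) -[h _]/(h' _) -[k _]/(k' _) !linear_sum.
  by apply: eq_bigr => i _; rewrite !linearZ /= hk.
have lin_inner g : linear (inner g : E -> R) by move=> a u w; rewrite linearP.
have ker0 : lker (linfun F') == 0%VS.
  apply/lker0P => u v; rewrite !lfunE /= => /rowP uv.
  apply/eqP; rewrite -subr_eq0 -normr_eq0 -sqrf_eq0 -inner_normE linearBl.
  rewrite subr_eq0; apply/eqP; apply: (eq_on_basis (inner u) (inner v)) => // i.
  by have := uv i; rewrite !mxE.
have full : limg (linfun F') = fullv.
  apply/eqP; rewrite eqEdim subvf limg_dim_eq; last first.
    by rewrite (eqP ker0) capv0.
  by rewrite [X in (X <= _)%N]dimvf dim_matrix mul1r leqnn.
have := memvf (\row_(i < \dim {: E}) 'd phi x b`_i); rewrite -full.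
move=> /memv_imgP[g _]; rewrite lfunE /= => /rowP gE.
exists g; apply: eq_on_basis => // [a u v|i]; first by rewrite linearP.
by have := gE i; rewrite !mxE.
Qed.

Lemma stationarity_proj phi C x v :
  proj_set (tangent_cone C x) (- gradient phi x) v -> `|v| = stationarity phi C x.
Proof.
rewrite /stationarity -[in RHS](normrN (gradient phi x)).
set u := - gradient phi x; set T := tangent_cone C x => -[Tv vmin].
have scaleT c : 0 < c -> T (c *: v).
  move=> c0; case: Tv => xs [t [Cxs cvx t0 cvt]].
  exists xs, (fun i => c^-1 * t i); split => // [i|].
    by rewrite mulr_gt0// invr_gt0.
  under eq_fun do rewrite invfM invrK -scalerA.
  exact: cvgZr.
have sqE z : `|u - z| ^+ 2 = `|u| ^+ 2 - 2 * inner u z + `|z| ^+ 2.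
  rewrite -!inner_normE linearBl linearBr /= linearBr /= (innerC z u); ring.
have minE c : 0 < c -> 
    - 2 * inner u v + `|v| ^+ 2 <= - 2 * (c * inner u v) + c ^+ 2 * `|v| ^+ 2.
  move=> c0; have := vmin _ (scaleT _ c0).
  rewrite -ler_sqr ?nnegrE// !sqE linearZr /= normrZ exprMn (gtr0_norm c0).
  lra.
have vE : inner u v = `|v| ^+ 2.
  have [->|v0] := eqVneq v 0; first by rewrite linear0r normr0 expr0n.
  have b0 : 0 < `|v| ^+ 2 by rewrite exprn_gt0// normr_gt0.
  have [a0|a0] := ltP 0 (inner u v); last first.
    have := minE _ (@ltr0Sn _ 1 : 0 < 2); have := minE 2^-1 ltac:(lra).
    set b := `|v| ^+ 2 in b0 *; nra.
  have := minE _ (divr_gt0 a0 b0).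
  move: a0 b0; set a := inner u v; set b := `|v| ^+ 2 => a0 b0.
  have -> : - 2 * (a / b * a) + (a / b) ^+ 2 * b = - (a ^+ 2 / b).
    by field; rewrite gt_eqF.
  rewrite lerNr ler_pdivrMr// => H.
  apply/eqP; rewrite -subr_eq0 -sqrf_eq0 eq_le sqr_ge0 andbT; nra.
have dE : set_dist u T = `|u - v|.
  apply/eqP; rewrite eq_le; apply/andP; split.
    apply: ge_inf; last by exists v.
    by exists 0 => _ [z _ <-].
  apply: lb_le_inf; first by exists `|u - v|, v.
  by move=> _ [z Tz <-]; exact: vmin.
rewrite dE sqE vE.
have -> : `|u| ^+ 2 - (`|u| ^+ 2 - 2 * `|v| ^+ 2 + `|v| ^+ 2) = `|v| ^+ 2 by ring.
by rewrite sqrtr_sqr normr_id.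
Qed.

End Definitions.

(* Main.v *)
From HB Require Import structures.
Require Import Defs.
From mathcomp Require Import all_boot all_order all_algebra.
From mathcomp Require Import all_classical all_reals all_analysis.
From mathcomp Require Import ring lra.
Import Order.TTheory GRing.Theory Num.Theory.
Import numFieldNormedType.Exports.
Local Open Scope classical_set_scope.
Local Open Scope ring_scope.

(** Pick [w] in [N_C(x)] outside the regular normal cone, together with
    [xs i --> x] and regular normals [ws i --> w] at [xs i]. The linear function
    [phi = - <w, .>] has [- grad phi = w] everywhere, and both measures of
    stationarity at [xs i] are at most [`|w - ws i|]: since [<ws i, z> <= 0] for
    [z] tangent at [xs i],
    [`|w - z|^2 >= `|w|^2 - 2 `|w - ws i| `|z| + `|z|^2 >= `|w|^2 - `|w - ws i|^2]. *)

Section Euclidean.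
Context {R : realType} {E : euclideanType R}.
Implicit Types (C S : set E) (x y u v w : E).

Lemma sqr_normB u v : `|u - v| ^+ 2 = `|u| ^+ 2 - 2 * inner u v + `|v| ^+ 2.
Proof.
rewrite -!inner_normE linearBl linearBr /= linearBr /= (innerC v u); ring.
Qed.

(** Cauchy-Schwarz (one-sided), read off from the triangle inequality for [u + v] by squaring and
    expanding. *)
Lemma inner_le_norm u v : inner u v <= `|u| * `|v|.
Proof.
have := ler_normB u (- v); rewrite opprK normrN => uv.
have := sqr_normB u (- v); rewrite opprK normrN linearNr /= => uvE.
have := normr_ge0 (u + v); nra.
Qed.

(** Uniqueness of the Riesz representative: it determines the value of [gradient], which is chosen
    by [get]. *)
Lemma inner_injl u v : inner u =1 inner v -> u = v.
Proof.
move=> uv; apply/eqP; rewrite -subr_eq0 -normr_eq0 -sqrf_eq0 -inner_normE.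
by rewrite linearBl /= uv subrr.
Qed.

Lemma inner_continuous u : continuous (inner u : E -> R).
Proof.
move=> v; apply/cvgrPdist_le => e e0.
(* The [+ 1] keeps the denominator positive when [u = 0]. *)
have d0 : 0 < e / (`|u| + 1) by rewrite divr_gt0// ltr_wpDl.
near=> z.
have uz : `|v - z| <= e / (`|u| + 1).
  by near: z; move/cvgrPdist_le: (@cvg_id _ (nbhs v)); exact.
rewrite -linearBr /= ler_norml; apply/andP.
have ub : `|u| * `|v - z| <= e.
  rewrite (le_trans (ler_wpM2l _ uz))// mulrCA ler_piMr ?(ltW e0)//.
  by rewrite ler_pdivrMr ?ltr_wpDl// mul1r lerDl.
(* Cauchy-Schwarz at [v - z] and at its opposite bounds both signs of the inner product. *)
have := inner_le_norm u (v - z); have := inner_le_norm u (- (v - z)).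
rewrite normrN linearNr /=; lra.
Unshelve. all: by end_near. Qed.

Lemma diff_inner u x :
  differentiable (inner u : E -> R) x /\ 'd (inner u : E -> R) x = inner u :> (E -> R).
Proof.
have lin : linear (inner u : E -> R^o) by move=> a v w; rewrite linearP.
pose f : {linear E -> R^o} :=
  HB.pack (inner u : E -> R^o) (GRing.isLinear.Build _ _ _ _ (inner u : E -> R^o) lin).
have fc : continuous f by exact: inner_continuous.
by split; [exact: (@linear_differentiable _ _ _ f)|exact: (@diff_lin _ _ _ f)].
Qed.

Lemma gradient_inner u x : gradient (inner u) x = u.
Proof.
by apply: inner_injl => v; rewrite -gradientP (diff_inner u x).2.
Qed.

Lemma tangent_cone0 {C x} : C x -> tangent_cone C x 0.
Proof.
move=> Cx; exists (fun=> x), (fun=> 1); split => //; first exact: cvg_cst.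
by under eq_fun do rewrite subrr scaler0; exact: cvg_cst.
Qed.

Lemma regular_normal_cone_sub C x : C x ->
  regular_normal_cone C x `<=` normal_cone C x.
Proof.
by move=> Cx w xw; exists (fun=> x), (fun=> w); split => //; exact: cvg_cst.
Qed.

Lemma set_dist_itv x S y : S y -> 0 <= set_dist x S <= `|x - y|.
Proof.
move=> Sy; apply/andP; split.
  by apply: lb_le_inf; [exists `|x - y|, y|move=> _ [z _ <-]].
by apply: ge_inf; [exists 0 => _ [z _ <-]|exists y].
Qed.

Lemma stationarity_le phi C x w : C x -> regular_normal_cone C x w ->
  stationarity phi C x <= `|- gradient phi x - w|.
Proof.
move=> Cx xw; rewrite /stationarity -(normrN (gradient phi x)).
set u := - gradient phi x; set e := `|u - w|.
have sqrtE (y : E) : `|y| = Num.sqrt (`|y| ^+ 2) by rewrite sqrtr_sqr normr_id.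
rewrite [leRHS]sqrtE -/e ler_sqrt ?sqr_ge0//.
(* If [|u| <= e], subtracting the squared distance only helps. Otherwise the claim becomes
   [sqrt (|u|^2 - e^2) <= d], a lower bound to check at each tangent [z]. *)
have [ue|eu] := leP (`|u| ^+ 2 - e ^+ 2) 0.
  by have := sqr_ge0 (set_dist u (tangent_cone C x)); lra.
rewrite lerBlDl -lerBlDr -[leLHS]sqr_sqrtr ?(ltW eu)//.
(* The tangent vector 0 makes the set of distances nonempty, so that its [inf] is a genuine
   infimum. *)
have T0 := tangent_cone0 Cx; have /andP[d0 _] := set_dist_itv u _ _ T0.
rewrite ler_sqr ?nnegrE ?sqrtr_ge0//.
apply: lb_le_inf; first by exists `|u - 0|, 0.
move=> _ [z Tz <-]; rewrite [leRHS]sqrtE ler_sqrt ?sqr_ge0//.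
rewrite sqr_normB; have := xw z Tz; have := inner_le_norm (u - w) z.
rewrite linearBl /= -/e => uwz wz.
(* As [<u, z> <= <u - w, z> <= e |z|], the square of [e - |z|] is what remains to be nonnegative. *)
have := sqr_ge0 (e - `|z|); nra.
Qed.

End Euclidean.

Theorem proposition2p10 (R : realType) (E : euclideanType R) (C : set E)
    (C_nonempty : C !=set0) (C_closed : closed C) (x : E) (Cx : C x)
    (x_not_regular : ~ clarke_regular C x) :
  exists (xs : nat -> E) (phi : E -> R),
    (forall i, C (xs i)) /\
    xs @ \oo --> x /\
    continuously_differentiable phi /\
    (fun i => stationarity phi C (xs i)) @ \oo --> (0 : R) /\
    (fun i => set_dist (- gradient phi (xs i)) (regular_normal_cone C (xs i)))
      @ \oo --> (0 : R) /\
    (normal_cone C x `\` regular_normal_cone C x) (- gradient phi x).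
Proof.
(* One inclusion always holds, so the two cones can differ only by such a [w]. *)
have [w [Nw nNw]] : exists w, (normal_cone C x `\` regular_normal_cone C x) w.
  apply: contrapT => /forallNP noW; apply: x_not_regular; apply/seteqP.
  split; first exact: regular_normal_cone_sub.
  by move=> w Nw; apply: contrapT => nNw; exact: (noW w).
have [xs [ws [Cxs xs_x ws_w Nws]]] := Nw.
have gradE y : gradient (inner (- w)) y = - w by exact: gradient_inner.
have ws0 : (fun i => `|w - ws i|) @ \oo --> (0 : R).
  rewrite -[X in _ --> X](normr0 E) -(subrr w).
  by apply: cvg_norm; apply: cvgB => //; exact: cvg_cst.
exists xs, (inner (- w)); split=> //; split=> //; split; last split; last split.
- split=> [y|]; first exact: (diff_inner _ _).1.
  by rewrite (_ : gradient _ = cst (- w)) ?funeqE//; exact: cst_continuous.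
- apply: squeeze_cvgr (cvg_cst 0) ws0; apply: nearW => i.
  rewrite sqrtr_ge0/=.
  by have := stationarity_le (inner (- w)) _ _ _ (Cxs i) (Nws i); rewrite gradE opprK.
(* [ws i] lies in the regular normal cone at [xs i], so the distance from [w] to that cone is at
   most [|w - ws i|]. *)
- apply: squeeze_cvgr (cvg_cst 0) ws0; apply: nearW => i.
  by rewrite gradE opprK; exact: set_dist_itv (Nws i).
- by rewrite gradE opprK.
Qed.
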